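(* Let $S\subseteq\mathbb{R}^n$ be a non-empty set with $0\in S$, let $f:S\to\mathbb{R}^n$ be locally Lipschitz with $f(0)=0$, and let $h:S\to\mathbb{R}^k$ be continuous with $h(0)=0$. Assume that the system $\dot x=f(x)$, $x\in S$, is forward complete, and consider it with output $y=h(x)$. Let $\Omega\subseteq S$ be a positively invariant set for $\dot x=f(x)$ with $0\in\Omega$. Suppose that there exist functions $a,b\in K_\infty$, $V,W\in C^1(\Omega;\mathbb{R}_+)$ and a continuous, positive definite function $\rho:\mathbb{R}_+\to\mathbb{R}_+$ such that for all $x\in\Omega$: $$a(|h(x)|)\le V(x)\le b(|x|),\qquad \nabla V(x)f(x)\le-\rho(W(x)),\qquad a(|h(x)|)\le W(x).$$ Moreover, suppose that there exists a continuous function $\gamma:\mathbb{R}_+\to\mathbb{R}_+$ such that one of the following holds: either $\nabla W(x)f(x)\le\gamma(V(x))$ for all $x\in\Omega$, or $\nabla W(x)f(x)\ge-\gamma(V(x))$ for all $x\in\Omega$. Finally, suppose that either $\rho$ is non-decreasing or there exists a continuous function $\zeta:\mathbb{R}_+\to\mathbb{R}_+$ such that $W(x)\le\zeta(V(x))$ for all $x\in\Omega$. Then the system $\dot x=f(x)$ with output $y=h(x)$ is Asymptotically Output Stable (AOS) on $\Omega$.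
   Context: $\mathbb{R}_+=[0,+\infty)$; $|\cdot|$ is the Euclidean norm; $B_R=\{x\in\mathbb{R}^n:|x|<R\}$. $K_\infty$ is the class of strictly increasing continuous functions $a:\mathbb{R}_+\to\mathbb{R}_+$ with $a(0)=0$ and $\lim_{s\to+\infty}a(s)=+\infty$. A function $\rho:\mathbb{R}_+\to\mathbb{R}_+$ is positive definite if $\rho(0)=0$ and $\rho(s)>0$ for $s>0$. Convention on $C^1$: for a set $A\subseteq\mathbb{R}^n$ lying between an open set and its closure, $C^1(A;\mathbb{R}_+)$ is the class of functions $A\to\mathbb{R}_+$ having continuous first-order derivatives in the interior of $A$ that can be continued continuously to all boundary points belonging to $A$. $\nabla V(x)=\left(\frac{\partial V}{\partial x_1}(x),\ldots,\frac{\partial V}{\partial x_n}(x)\right)$ (row vector). Forward complete: for every $x_0\in S$ the unique solution $x(t)=\phi(t,x_0)$ of $\dot x=f(x)$, $x(0)=x_0$, exists for all $t\ge0$ and satisfies $\phi(t,x_0)\in S$ for all $t\ge 0$. $\Omega$ is positively invariant if $\phi(t,x_0)\in\Omega$ for all $x_0\in\Omega$, $t\ge0$. Write $y(t,x_0)=h(\phi(t,x_0))$. The system is: - Lagrange output stable on $\Omega$ if for every $R>0$ the set $\{|y(t,x_0)|:x_0\in B_R\cap\Omega,\ t\ge0\}$ is bounded; - Lyapunov output stable on $\Omega$ if for every $\varepsilon>0$ there exists $\delta(\varepsilon)>0$ such that for all $x_0\in B_{\delta(\varepsilon)}\cap\Omega$ it holds that $|y(t,x_0)|\le\varepsilon$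 for all $t\ge0$; - AOS on $\Omega$ if it is Lagrange and Lyapunov output stable on $\Omega$ and $\lim_{t\to+\infty}y(t,x_0)=0$ for all $x_0\in\Omega$. *)

(* Defs.v *)
From HB Require Import structures.
From mathcomp Require Import all_boot all_order all_algebra.
From mathcomp Require Import all_classical all_reals all_analysis.
Set Implicit Arguments.
Unset Strict Implicit.
Unset Printing Implicit Defensive.
Import Order.TTheory GRing.Theory Num.Theory.
Import numFieldNormedType.Exports.
Local Open Scope classical_set_scope.
Local Open Scope ring_scope.

(* The library norm `|x| of a row vector is the sup norm. It induces the same
   topology and the same locally Lipschitz maps as the Euclidean norm. *)
Definition enorm (R : realType) (n : nat) (x : 'rV[R]_n) : R :=
  Num.sqrt (\sum_(i < n) x 0 i ^+ 2).

Definition dot (R : realType) (n : nat) (u v : 'rV[R]_n) : R :=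
  \sum_(i < n) u 0 i * v 0 i.

(* Functions on R_+ = [0, +oo[ are represented by functions on R of which only
   the values on `[0, +oo[ matter; likewise for functions on subsets of R^n. *)
Definition continuous_Rplus (R : realType) (g : R -> R) : Prop :=
  (forall s, 0 <= s -> 0 <= g s) /\ {within `[0, +oo[, continuous g}.

Definition K_infty (R : realType) (a : R -> R) : Prop :=
  [/\ continuous_Rplus a,
      {in `[0, +oo[ &, {homo a : s t / s < t}},
      a 0 = 0 &
      a s @[s --> +oo] --> +oo].

Definition positive_definite (R : realType) (rho : R -> R) : Prop :=
  rho 0 = 0 /\ (forall s, 0 < s -> 0 < rho s).

Definition between_open_and_closure (T : topologicalType) (A : set T) : Prop :=
  exists U : set T, [/\ open U, U `<=` A & A `<=` closure U].

(* G is the row of partial derivatives of V in the interior of A, continued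
   continuously to the whole of A. *)
Definition is_gradient (R : realType) (n : nat) (A : set 'rV[R]_n)
    (V : 'rV[R]_n -> R) (G : 'rV[R]_n -> 'rV[R]_n) : Prop :=
  (forall x, A° x -> forall i, is_derive x (delta_mx 0 i) V (G x 0 i)) /\
  {within A, continuous G}.

(* C^1(A; R_+), for A lying between an open set and its closure. Only the
   derivatives of V are required to extend continuously to the boundary points
   of A in A. *)
Definition C1_Rplus (R : realType) (n : nat) (A : set 'rV[R]_n)
    (V : 'rV[R]_n -> R) : Prop :=
  (forall x, A x -> 0 <= V x) /\ exists G, is_gradient A V G.

(* When A lies between an open set and its closure, all G such that
   is_gradient A V G agree on A. *)
Definition grad (R : realType) (n : nat) (A : set 'rV[R]_n)
    (V : 'rV[R]_n -> R) : 'rV[R]_n -> 'rV[R]_n :=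
  xget (fun=> 0) [set G | is_gradient A V G].

(* x solves x' = f(x), x(0) = x0 on [0, +oo[ with values in S. The right
   derivative of x at 0 is then f x0 as soon as f is continuous on S. *)
Definition is_solution (R : realType) (n : nat) (S : set 'rV[R]_n)
    (f : 'rV[R]_n -> 'rV[R]_n) (x0 : 'rV[R]_n) (x : R -> 'rV[R]_n) : Prop :=
  [/\ x 0 = x0,
      forall t, 0 <= t -> S (x t),
      derivable_oy_Rcontinuous x 0 &
      forall t, 0 < t -> derive1 x t = f (x t)].

(* For f locally Lipschitz on S, two solutions agree on [0, +oo[, so existence
   alone is required. *)
Definition forward_complete (R : realType) (n : nat) (S : set 'rV[R]_n)
    (f : 'rV[R]_n -> 'rV[R]_n) : Prop :=
  forall x0, S x0 -> exists x, is_solution S f x0 x.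

(* flow S f t x0 is the state at time t >= 0 of the solution starting at x0. *)
Definition flow (R : realType) (n : nat) (S : set 'rV[R]_n)
    (f : 'rV[R]_n -> 'rV[R]_n) (t : R) (x0 : 'rV[R]_n) : 'rV[R]_n :=
  xget (fun=> x0) [set x | is_solution S f x0 x] t.

Definition positively_invariant (R : realType) (n : nat) (S : set 'rV[R]_n)
    (f : 'rV[R]_n -> 'rV[R]_n) (Omega : set 'rV[R]_n) : Prop :=
  forall x0 t, Omega x0 -> 0 <= t -> Omega (flow S f t x0).

Section OutputStability.
Context (R : realType) (n k : nat) (S : set 'rV[R]_n).
Context (f : 'rV[R]_n -> 'rV[R]_n) (h : 'rV[R]_n -> 'rV[R]_k).
Context (Omega : set 'rV[R]_n).

Definition output (t : R) (x0 : 'rV[R]_n) : 'rV[R]_k := h (flow S f t x0).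

Definition Lagrange_output_stable : Prop :=
  forall r, 0 < r -> exists M, forall x0 t,
    enorm x0 < r -> Omega x0 -> 0 <= t -> enorm (output t x0) <= M.

Definition Lyapunov_output_stable : Prop :=
  forall eps, 0 < eps -> exists2 delta, 0 < delta & forall x0,
    enorm x0 < delta -> Omega x0 ->
    forall t, 0 <= t -> enorm (output t x0) <= eps.

Definition AOS : Prop :=
  [/\ Lagrange_output_stable,
      Lyapunov_output_stable &
      forall x0, Omega x0 -> output t x0 @[t --> +oo] --> (0 : 'rV[R]_k)].

End OutputStability.

(* Main.v *)
(* V and W need not be continuous at the points of Omega on its boundary (only
   their gradients extend there), so the Lyapunov argument is run on
   trajectories starting in the interior of Omega and then passed to the limit.
   - The interior is invariant: for short times the flow is the identity plus a
     contraction, so it maps a small ball onto a neighbourhood of the image of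
     its center, and this neighbourhood lies in Omega.
   - Along an interior trajectory V is nonincreasing. If |y| > e at time t, then
     W >= a(e), and the one-sided bound on the derivative of W keeps
     W >= a(e) / 2 on an interval of fixed length d just before or just after t,
     during which V drops by a fixed amount. So the number of such times that
     are 2 d apart is bounded uniformly over the points with V <= B.
   - Interior points are dense in Omega and the flow is continuous in the
     initial state, so the bounds on the output, each of which involves finitely
     many times, hold on Omega. *)
Require Import Defs.
From HB Require Import structures.
From mathcomp Require Import all_boot all_order all_algebra.
From mathcomp Require Import all_classical all_reals all_analysis.
From mathcomp Require Import lra ring.
Set Implicit Arguments.
Unset Strict Implicit.
Unset Printing Implicit Defensive.
Import Order.TTheory GRing.Theory Num.Theory.
Import numFieldNormedType.Exports.
Local Open Scope classical_set_scope.
Local Open Scope ring_scope.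

(** * Tools: the sup norm, induction along the half-line, mean value estimates *)

Lemma coord_le_norm (R : realType) (n : nat) (u : 'rV[R]_n) (i : 'I_n) :
  `|u 0 i| <= `|u|.
Proof.
rewrite [leRHS]/Num.Def.normr/= mx_normrE.
exact: (le_bigmax _ (fun ij => `|u ij.1 ij.2|) (0, i)).
Qed.

Lemma norm_le_coord (R : realType) (n : nat) (u : 'rV[R]_n) (e : R) :
  0 <= e -> (forall i, `|u 0 i| <= e) -> `|u| <= e.
Proof.
move=> e0 ue; rewrite [leLHS]/Num.Def.normr/= mx_normrE.
by apply: bigmax_le => // -[i j] _ /=; rewrite ord1.
Qed.

(** Continuous induction. At the infimum [c] of the times where [P] fails, the step hypothesis
    carries [P] from a time just before [c] past it. Only a step size depending on [c] is asked for,
    which is what local ODE estimates provide. *)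
Lemma propagation (R : realType) (P : R -> Prop) : P 0 ->
  (forall c, 0 <= c -> exists2 eta, 0 < eta & forall s t,
     0 <= s -> s <= t -> c - eta < s -> t < c + eta -> P s -> P t) ->
  forall t, 0 <= t -> P t.
Proof.
move=> P0 Pstep T T0; apply: contrapT => nPT.
pose B := [set t : R | 0 <= t /\ ~ P t].
have lbB : lbound B 0 by move=> t [].
have infB : has_inf B by split; [exists T|exists 0].
have c0 : 0 <= inf B by apply: lb_le_inf => //; exists T.
have [eta eta0 step] := Pstep _ c0.
have [t [t0 nPt] tc] := inf_adherent eta0 infB.
have ct : inf B <= t by apply: ge_inf; [exists 0|split].
(* [P] holds at this starting time: it is either [0] or strictly below the infimum of the
   failures. *)
apply: nPt; apply: (step (Num.max 0 (inf B - eta / 2))) => //.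
- by rewrite le_max lexx.
- by rewrite ge_max t0 /=; lra.
- by rewrite lt_max; apply/orP; right; lra.
- have [h|h] := leP 0 (inf B - eta / 2); last by [].
  apply: contrapT => nP; have : inf B <= inf B - eta / 2.
    by apply: ge_inf; [exists 0|split].
  lra.
Qed.

Lemma increment_le (R : realType) (g dg : R -> R) (s t K : R) : s <= t ->
  (forall r, r \in `]s, t[ -> is_derive r 1 g (dg r)) ->
  {within `[s, t], continuous g} ->
  (forall r, r \in `]s, t[ -> dg r <= K) -> g t - g s <= K * (t - s).
Proof.
rewrite le_eqVlt => /predU1P[-> _ _ _|st dgg gc dgK].
  by rewrite !subrr mulr0.
have [c cst ->] := MVT st dgg gc.
by rewrite ler_wpM2r ?dgK// subr_ge0 ltW.
Qed.

Lemma increment_ge (R : realType) (g dg : R -> R) (s t K : R) : s <= t ->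
  (forall r, r \in `]s, t[ -> is_derive r 1 g (dg r)) ->
  {within `[s, t], continuous g} ->
  (forall r, r \in `]s, t[ -> K <= dg r) -> K * (t - s) <= g t - g s.
Proof.
move=> st dgg gc dgK; rewrite -lerN2 opprD -mulNr.
apply: (@increment_le R (fun r => - g r) (fun r => - dg r)) => // r.
- by move=> /dgg dr; exact: is_deriveN.
- by apply: continuousN; exact: gc.
- by move=> /dgK; rewrite lerN2.
Qed.

Lemma is_derive_coord (R : realType) (n : nat) (c : R -> 'rV[R]_n)
    (r : R) (dc : 'rV[R]_n) (i : 'I_n) :
  is_derive r 1 c dc -> is_derive r 1 (fun s => c s 0 i) (dc 0 i).
Proof.
move=> [cd cdE]; split; first by move/derivable_mxP: cd; exact.
by rewrite -cdE derive_mx// mxE.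
Qed.

(** The mean value theorem has no vector form with equality, so it is applied to each coordinate;
    the sup norm makes this lossless. *)
Lemma increment_norm_le (R : realType) (n : nat) (c dc : R -> 'rV[R]_n)
    (s t K : R) : s <= t ->
  (forall r, r \in `]s, t[ -> is_derive r 1 c (dc r)) ->
  {within `[s, t], continuous c} ->
  (forall r, r \in `]s, t[ -> `|dc r| <= K) -> `|c t - c s| <= K * (t - s).
Proof.
rewrite le_eqVlt => /predU1P[-> _ _ _|st dcc cc dcK].
  by rewrite !subrr mulr0 normr0.
have K0 : 0 <= K.
  by rewrite (le_trans _ (dcK ((s + t) / 2) _))// in_itv/=; apply/andP; split; lra.
apply: norm_le_coord => [|i]; first by rewrite mulr_ge0// subr_ge0 ltW.
have cci : {within `[s, t], continuous (fun r => c r 0 i)}.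
  move=> r; apply: (@continuous_comp _ _ _ _ (fun u : 'rV[R]_n => u 0 i)).
    exact: cc.
  exact: coord_continuous.
have dci r : r \in `]s, t[ -> is_derive r 1 (fun q => c q 0 i) (dc r 0 i).
  by move=> rst; exact/is_derive_coord/dcc.
have dciK r : r \in `]s, t[ -> - K <= dc r 0 i <= K.
  by move=> rst; rewrite -ler_norml (le_trans (coord_le_norm _ _))// dcK.
rewrite !mxE ler_norml -mulNr; apply/andP; split.
  by apply: (increment_ge (ltW st) dci cci) => r /dciK/andP[].
by apply: (increment_le (ltW st) dci cci) => r /dciK/andP[].
Qed.

(** * Solutions of the differential equation over short times *)

(** The local Lipschitz condition is a filter statement at the diagonal point [(p, p)]. A product of
    two balls lies in that filter, and the smaller radius serves both arguments. *)
Lemma locally_lipschitzE (R : realType) (n m : nat) (S : set 'rV[R]_n)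
    (f : 'rV[R]_n -> 'rV[R]_m) (p : 'rV[R]_n) :
  [locally [lipschitz f x | x in S]] -> S p ->
  exists e L : R, [/\ 0 < e, 0 < L & forall u v, S u -> S v ->
    `|u - p| < e -> `|v - p| < e -> `|f u - f v| <= L * `|u - v|].
Proof.
move=> /(_ (p, p)) /= + Sp => /(_ (conj Sp Sp)) flip.
have [L L0 Llip] : exists2 L : R, 0 < L &
    L.-lipschitz_on f (within (S `*` S) (nbhs (p, p))).
  near (+oo : set_system R) => L; exists L; first by near: L; exact: nbhs_pinfty_gt.
  by near: L; exact: flip.
move: Llip => /= [[A B] /= [/nbhs_ballP[e1 /= e10 pA] /nbhs_ballP[e2 /= e20 pB]] AB].
exists (Num.min e1 e2), L; split => // [|u v Su Sv].
  by rewrite lt_min e10 e20.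
rewrite !lt_min => /andP[u1 _] /andP[_ v2].
apply: (AB (u, v)) => //; split => /=.
  by apply: pA; rewrite -ball_normE /ball_ /= distrC.
by apply: pB; rewrite -ball_normE /ball_ /= distrC.
Unshelve. all: by end_near. Qed.

Section Solutions.
Context (R : realType) (n : nat) (S : set 'rV[R]_n) (f : 'rV[R]_n -> 'rV[R]_n).
Implicit Types (x y : R -> 'rV[R]_n) (u v p : 'rV[R]_n) (c e r s t : R).

Lemma solution_derive u0 x t : is_solution S f u0 x -> 0 < t ->
  is_derive t 1 x (f (x t)).
Proof.
move=> [_ _ [dx _] dxE] t0; split; last by rewrite -derive1E dxE.
by apply: dx; rewrite in_itv/= t0.
Qed.

Lemma solution_continuous u0 x : is_solution S f u0 x ->
  {within `[0, +oo[, continuous x}.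
Proof. by move=> [_ _ + _]; exact: derivable_oy_Rcontinuous_within_itvcy. Qed.

Lemma solution_continuous_segment u0 x s t : is_solution S f u0 x -> 0 <= s ->
  {within `[s, t], continuous x}.
Proof.
move=> /solution_continuous + s0; apply: continuous_subspaceW => r /=.
by rewrite !in_itv/= => /andP[sr _]; rewrite (le_trans s0 sr).
Qed.

Lemma solution_near u0 x c e : is_solution S f u0 x -> 0 <= c -> 0 < e ->
  exists2 eta, 0 < eta & forall s, 0 <= s -> `|s - c| < eta ->
    `|x s - x c| < e.
Proof.
move=> /solution_continuous/subspace_continuousP xc c0 e0.
have cc : (`[0, +oo[%classic : set R) c by rewrite /= in_itv/= c0.
have /cvgrPdist_lt /(_ _ e0) := xc c cc.
rewrite near_withinE => -[eta /= eta0 H]; exists eta => // s s0 sc.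
by rewrite distrC; apply: H => //=; [rewrite distrC|rewrite in_itv/= s0].
Qed.

Lemma solution_shift u0 x s : is_solution S f u0 x -> 0 <= s ->
  is_solution S f (x s) (fun t => x (s + t)).
Proof.
move=> xsol s0; have [_ Sx xd xE] := xsol.
have d1 t : 0 < t -> is_derive t 1 (fun t => x (s + t)) (f (x (s + t))).
  move=> t0; have st0 : 0 < s + t by rewrite ltr_wpDl.
  have dx := solution_derive xsol st0.
  have E : (fun h : R => h^-1 *: (x (s + (h *: 1 + t)) - x (s + t))) =
      (fun h => h^-1 *: (x (h *: 1 + (s + t)) - x (s + t))).
    by apply/funext => h; rewrite addrCA.
  have [dxd dxv] := dx; split; first by rewrite /derivable /= E; exact: dxd.
  by move: dxv; rewrite /derive /= E.
split.
- by rewrite addr0.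
- by move=> t t0; apply: Sx; rewrite addr_ge0.
- split; first by move=> t; rewrite in_itv/= andbT => /d1[].
  have := derivable_oy_continuousW s0 xd => -[_]; rewrite addr0 => xs.
  apply/cvgrPdist_lt => e e0.
  move/cvgrPdist_lt : xs => /(_ _ e0); rewrite !near_withinE.
  move=> [d /= d0 H]; exists d => //= t td t0; apply: H => /=.
    by move: td; rewrite opprD addrA subrr.
  by rewrite ltrDl.
- by move=> t t0; rewrite derive1E; exact: (@derive_val _ _ _ _ _ _ _ (d1 _ t0)).
Qed.

Lemma solution_increment u0 x s t K : is_solution S f u0 x ->
  0 <= s -> s <= t -> (forall r, s <= r <= t -> `|f (x r)| <= K) ->
  `|x t - x s| <= K * (t - s).
Proof.
move=> xsol s0 st fK.
apply: (increment_norm_le (dc := fun r => f (x r)) st) => [r||r].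
- rewrite in_itv/= => /andP[sr _]; apply: (solution_derive xsol).
  exact: le_lt_trans sr.
- exact: (solution_continuous_segment (u0 := u0)).
- by rewrite in_itv/= => /andP[sr rt]; apply: fK; rewrite !ltW.
Qed.

Lemma solutions_increment u0 v0 x y s t K :
  is_solution S f u0 x -> is_solution S f v0 y ->
  0 <= s -> s <= t -> (forall r, s <= r <= t -> `|f (x r) - f (y r)| <= K) ->
  `|x t - y t - (x s - y s)| <= K * (t - s).
Proof.
move=> xsol ysol s0 st fK.
apply: (increment_norm_le (c := fun r => x r - y r)
  (dc := fun r => f (x r) - f (y r)) st) => [r||r].
- rewrite in_itv/= => /andP[sr _]; have r0 := le_lt_trans s0 sr.
  have := solution_derive xsol r0; have := solution_derive ysol r0.
  by move=> dx dy; exact: is_deriveB.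
- move=> r; apply: continuousB.
    exact: (solution_continuous_segment (u0 := u0)).
  exact: (solution_continuous_segment (u0 := v0)).
- by rewrite in_itv/= => /andP[sr rt]; apply: fK; rewrite !ltW.
Qed.

(** The speed bound [K] is known only inside the ball, so confinement is bootstrapped: while the
    solution stays inside, it moves by at most [e / 4] from a start within [e / 2] of [p]. *)
Lemma solution_confined p (e K tau : R) : 0 < e -> 0 <= K -> K * tau <= e / 4 ->
  (forall u, S u -> `|u - p| < e -> `|f u| <= K) ->
  forall u0 x, is_solution S f u0 x -> `|u0 - p| < e / 2 ->
  forall t, 0 <= t <= tau -> `|x t - p| < e.
Proof.
move=> e0 K0 Ktau fK u0 x xsol u0p.
have [u0E Sx _ _] := xsol.
(* The propagated property covers the whole past of [t], since the increment estimate needs the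
   speed bound on all of it. *)
suff H t : 0 <= t -> t <= tau -> forall r, 0 <= r <= t -> `|x r - p| < e.
  by move=> t /andP[t0 tt]; apply: (H t) => //; rewrite t0 lexx.
move: t; apply: propagation => [_ r /andP[r0 r1]|c c0].
  by have -> : r = 0 by [lra]; rewrite u0E; lra.
have [eta eta0 near_c] := solution_near (e := e / 8) xsol c0 ltac:(lra).
exists eta => // s t s0 st cs tc Ps tt r /andP[r0 rt].
have [rs|sr] := leP r s; first by apply: Ps; [lra|rewrite r0].
(* This leaves a margin of [e / 4], which absorbs the two continuity errors of [e / 8] between
   [x s], [x c] and [x r]. *)
have xs : `|x s - p| < e * 3 / 4.
  have : `|x s - x 0| <= K * (s - 0).
    apply: (solution_increment xsol) => // q q0s.
    have /andP[q0 _] := q0s.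
    by apply: fK; [exact: Sx|apply: Ps => //; lra].
  have : K * s <= K * tau by rewrite ler_wpM2l//; lra.
  rewrite subr0 u0E => h1 h2.
  by have := ler_distD u0 (x s) p; lra.
have rc : `|x r - x c| < e / 8.
  by apply: near_c => //; rewrite ltr_norml; apply/andP; split; lra.
have sc : `|x s - x c| < e / 8.
  by apply: near_c => //; rewrite ltr_norml; apply/andP; split; lra.
have := ler_distD (x c) (x r) p; have := ler_distD (x s) (x c) p.
by rewrite (distrC (x c) (x s)); lra.
Qed.

(** The first estimate gives uniqueness and continuity in the initial state. The second says that
    the flow map is the identity up to a contraction, which makes it locally onto. *)
Lemma local_flow p : [locally [lipschitz f x | x in S]] -> S p ->
  exists e tau : R, [/\ 0 < e, 0 < tau & forall u0 v0 x y,
    is_solution S f u0 x -> is_solution S f v0 y ->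
    `|u0 - p| < e -> `|v0 - p| < e ->
    forall t, 0 <= t <= tau -> `|x t - y t| <= 2 * `|u0 - v0| /\
      `|x t - y t - (u0 - v0)| <= 1 / 2 * `|u0 - v0| ].
Proof.
move=> flip Sp; have [e [L [e0 L0 Le]]] := locally_lipschitzE flip Sp.
pose K := `|f p| + L * e.
have Le0 : 0 < L * e by rewrite mulr_gt0.
have K0 : 0 < K by rewrite /K ltr_wpDl.
have fK u : S u -> `|u - p| < e -> `|f u| <= K.
  move=> Su up; have := Le u p Su Sp up; rewrite subrr normr0 => /(_ e0) h.
  have : L * `|u - p| <= L * e by rewrite ler_pM2l// ltW.
  by have := ler_normD (f u - f p) (f p); rewrite subrK /K; lra.
(* The first term confines both solutions to the ball where [f] is Lipschitz. The second gives
   [L * tau <= 1 / 3], hence [D <= 3 / 2 * |u0 - v0|] and a deviation from the identity of at most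
   [D / 3]. *)
pose tau := Num.min (e / 4 / K) (1 / 3 / L).
have tau0 : 0 < tau by rewrite lt_min !divr_gt0.
have Ktau : K * tau <= e / 4.
  by rewrite mulrC -ler_pdivlMr// ge_min lexx.
have Ltau : L * tau <= 1 / 3.
  by rewrite mulrC -ler_pdivlMr// ge_min lexx orbT.
exists (e / 2), tau; split => // [|u0 v0 x y xsol ysol u0p v0p]; first lra.
have xp := solution_confined e0 (ltW K0) Ktau fK xsol u0p.
have yp := solution_confined e0 (ltW K0) Ktau fK ysol v0p.
have [u0E Sx _ _] := xsol; have [v0E Sy _ _] := ysol.
have dc : {within `[0, tau], continuous (fun t => `|x t - y t|)}.
  move=> t; apply: cvg_norm; apply: continuousB.
    exact: (solution_continuous_segment (u0 := u0)).
  exact: (solution_continuous_segment (u0 := v0)).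
have [c + cmax] := EVT_max (ltW tau0) dc.
(* Integrating gives D <= |u0 - v0| + L tau D, in place of Gronwall's lemma. *)
set D := `|x c - y c| in cmax *; rewrite in_itv/= => ctau.
have D0 : 0 <= D by rewrite /D.
have incr t : 0 <= t <= tau -> `|x t - y t - (u0 - v0)| <= 1 / 3 * D.
  move=> /andP[t0 tt]; rewrite -{1}u0E -{1}v0E.
  have : `|x t - y t - (x 0 - y 0)| <= (L * D) * (t - 0).
    apply: (solutions_increment xsol ysol) => // r /andP[r0 rt].
    have rtau : 0 <= r <= tau by lra.
    apply: le_trans (Le _ _ (Sx _ r0) (Sy _ r0) (xp _ rtau) (yp _ rtau)) _.
    by rewrite ler_pM2l// cmax// in_itv.
  move=> /le_trans; apply; rewrite subr0 mulrAC ler_wpM2r//.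
  by apply: le_trans Ltau; rewrite ler_pM2l.
have DE : D <= 3 / 2 * `|u0 - v0|.
  have := incr c ctau; have := ler_normD (x c - y c - (u0 - v0)) (u0 - v0).
  by rewrite subrK -/D; lra.
move=> t tt; split; last by have := incr t tt; lra.
have : `|x t - y t| <= D by apply: cmax; rewrite in_itv.
have := normr_ge0 (u0 - v0); lra.
Qed.

End Solutions.

(** Registers the completeness of row vectors for the Banach fixed point theorem. *)
HB.instance Definition _ (R : realType) (n : nat) := Complete.on 'rV[R]_n.

(** Solutions of [g v = z] are the fixed points of [F v = v - g v + z]. This map is a contraction of
    ratio [1 / 2] and moves [q] by at most [r / 2], so it preserves the closed ball of radius [r]
    about [q]. *)
Lemma near_identity_solve (R : realType) (n : nat) (g : 'rV[R]_n -> 'rV[R]_n)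
    (q z : 'rV[R]_n) (r : R) : 0 < r ->
  (forall v w, `|v - q| <= r -> `|w - q| <= r ->
     `|g v - g w - (v - w)| <= 1 / 2 * `|v - w|) ->
  `|z - g q| <= r / 2 -> exists2 v, `|v - q| <= r & g v = z.
Proof.
move=> r0 gc zq.
pose U := [set v : 'rV[R]_n | `|v - q| <= r].
pose F v := v - g v + z.
have Fc v w : U v -> U w -> `|F v - F w| <= 1 / 2 * `|v - w|.
  move=> Uv Uw; rewrite (_ : F v - F w = - (g v - g w - (v - w))) ?normrN.
    exact: gc.
  by apply/rowP => i; rewrite /F !mxE; ring.
have qU : U q by rewrite /U/= subrr normr0 ltW.
have FU : {homo F : v / U v >-> U v}.
  move=> v Uv; rewrite /U/=.
  have := Fc v q Uv qU; have : `|F q - q| = `|z - g q|.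
    by congr `|_|; apply/rowP => i; rewrite /F !mxE; ring.
  have := ler_distD (F q) (F v) q; move: Uv; rewrite /U/=; lra.
have half0 : 0 <= 1 / 2 :> R by [].
have ctr : is_contraction (mkfun_fun FU).
  exists (NngNum half0); split; first by rewrite /=; lra.
  by move=> [v w] [/= Uv Uw]; exact: Fc.
have clU : closed U.
  rewrite (_ : U = closed_ball_ Num.norm q r).
    exact: closed_closed_ball_.
  by apply/seteqP; split => v; rewrite /U /closed_ball_ /= distrC.
have [v Uv vE] := banach_fixed_point ctr clU (ex_intro _ q qU).
exists v => //; move: vE; rewrite /= /mkfun /F => /rowP vE.
by apply/rowP => i; have := vE i; rewrite !mxE; lra.
Qed.

(** * The flow: continuity in the initial state and invariance of the interior *)

Section Flow.
Context (R : realType) (n : nat) (S : set 'rV[R]_n) (f : 'rV[R]_n -> 'rV[R]_n).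
Context (f_lip : [locally [lipschitz f x | x in S]]).
Context (S_complete : forward_complete S f).
Implicit Types (u v p q : 'rV[R]_n) (c e r s t : R).

Lemma flow_solution u : S u -> is_solution S f u (fun t => flow S f t u).
Proof.
by move=> Su; rewrite /flow; apply: (xgetPex (fun=> u)); exact: S_complete.
Qed.

Lemma flow0 u : S u -> flow S f 0 u = u.
Proof. by move=> /flow_solution[]. Qed.

Lemma flow_in u t : S u -> 0 <= t -> S (flow S f t u).
Proof. by move=> /flow_solution[_ + _ _]; exact. Qed.

(** [local_flow] in the form of a step for [propagation]. It speaks of arbitrary solutions so that
    it applies both to flows and to shifted trajectories. *)
Lemma flow_local_step u c : S u -> 0 <= c ->
  exists e eta : R, [/\ 0 < e, 0 < eta & forall s t,
    0 <= s -> s <= t -> c - eta < s -> t < c + eta ->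
    forall p q x y, is_solution S f p x -> is_solution S f q y ->
      `|p - flow S f s u| < e -> `|q - flow S f s u| < e ->
      `|x (t - s) - y (t - s)| <= 2 * `|p - q| /\
      `|x (t - s) - y (t - s) - (p - q)| <= 1 / 2 * `|p - q| ].
Proof.
move=> Su c0; have usol := flow_solution Su.
have [e [tau [e0 tau0 loc]]] := local_flow f_lip (flow_in Su c0).
have [eta eta0 near_c] := solution_near (e := e / 2) usol c0 ltac:(lra).
(* Both [s] and [t] lie within [tau / 2] of [c] on the relevant side, so [t - s <= tau]; the other
   half of [e] pays for the distance between the states at times [s] and [c]. *)
exists (e / 2), (Num.min eta (tau / 2)); split; first lra.
  by rewrite lt_min eta0; lra.
move=> s t s0 st cs tc; have : Num.min eta (tau / 2) <= eta by rewrite ge_min lexx.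
have : Num.min eta (tau / 2) <= tau / 2 by rewrite ge_min lexx orbT.
move: cs tc; set m := Num.min _ _ => cs tc m1 m2.
have near_s : `|flow S f s u - flow S f c u| < e / 2.
  by apply: near_c => //; rewrite ltr_norml; apply/andP; split; lra.
move=> p q x y xsol ysol ps qs; apply: loc => //.
- by have := ler_distD (flow S f s u) p (flow S f c u); lra.
- by have := ler_distD (flow S f s u) q (flow S f c u); lra.
- by lra.
Qed.

Lemma flow_continuous u t : S u -> 0 <= t -> forall e, 0 < e ->
  exists2 d, 0 < d & forall v, S v -> `|v - u| < d ->
    `|flow S f t v - flow S f t u| < e.
Proof.
move=> Su; move: t; apply: propagation => [e e0|c c0].
  by exists e => // v Sv vu; rewrite !flow0.
have [e1 [eta [e10 eta0 step]]] := flow_local_step Su c0.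
exists eta => // s t s0 st cs tc Ps e e0.
have loc := step s t s0 st cs tc.
(* The local step at most doubles distances, hence [e / 2] at time [s]. *)
have [d d0 dP] := Ps (Num.min e1 (e / 2)) ltac:(by rewrite lt_min e10; lra).
exists d => // v Sv vu; have := dP v Sv vu; rewrite lt_min => /andP[v1 v2].
have := loc _ _ _ _ (solution_shift (flow_solution Sv) s0)
  (solution_shift (flow_solution Su) s0) v1.
by rewrite subrr normr0 (addrC s) subrK => /(_ e10)[]; lra.
Qed.

Lemma interior_invariant (Omega : set 'rV[R]_n) u t : Omega `<=` S ->
  positively_invariant S f Omega -> Omega° u -> 0 <= t ->
  Omega° (flow S f t u).
Proof.
move=> OS Oinv Ou; have Su : S u by apply: OS; exact: interior_subset.
move: t; apply: propagation => [|c c0]; first by rewrite flow0.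
have [e [eta [e0 eta0 step]]] := flow_local_step Su c0.
exists eta => // s t s0 st cs tc Ps.
have := step s t s0 st cs tc; set q := flow S f s u in Ps * => loc.
move/nbhs_ballP : (Ps) => [r1 /= r10]; rewrite -ball_normE /ball_ /= => r1O.
(* The closed ball of radius [r] about [q] must lie in [Omega] and in the range of the local
   estimate. *)
pose r := Num.min (r1 / 2) (e / 2).
have r0 : 0 < r by rewrite lt_min; apply/andP; split; lra.
have rr1 : r <= r1 / 2 by rewrite ge_min lexx.
have re : r <= e / 2 by rewrite ge_min lexx orbT.
have UO v : `|v - q| <= r -> Omega v.
  by move=> vq; apply: r1O => /=; rewrite distrC; lra.
have ts0 : 0 <= t - s by lra.
(* Semigroup property: both solutions start at [q], so the local Lipschitz bound between them is
   zero. *)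
have qt : flow S f (t - s) q = flow S f t u.
  have := loc _ _ _ _ (flow_solution (flow_in Su s0))
    (solution_shift (flow_solution Su) s0).
  rewrite subrr normr0 !mulr0 => /(_ e0 e0)[+ _].
  by rewrite (addrC s) subrK normr_le0 subr_eq0 => /eqP.
apply/nbhs_ballP; exists (r / 2) => /=; first by lra.
rewrite -ball_normE /ball_ => z /= zq.
have [||v vq <-] := @near_identity_solve R n (flow S f (t - s)) q z r r0.
- move=> v w vq wq; have := loc _ _ _ _ (flow_solution (OS _ (UO _ vq)))
    (flow_solution (OS _ (UO _ wq))).
  by move=> /(_ ltac:(lra) ltac:(lra))[].
- by rewrite qt distrC ltW.
- exact: Oinv (UO _ vq) ts0.
Qed.

End Flow.

(** * Continuous partial derivatives give differentiability; the chain rule *)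

Lemma is_derive_line (R : realType) (n : nat) (V : 'rV[R]_n -> R)
    (a w : 'rV[R]_n) (s d : R) :
  is_derive (a + s *: w) w V d -> is_derive s 1 (fun r => V (a + r *: w)) d.
Proof.
move=> [Vd VdE].
have E : (fun h : R => h^-1 *: (V (a + (h *: (1 : R) + s) *: w) - V (a + s *: w))) =
    (fun h => h^-1 *: (V (h *: w + (a + s *: w)) - V (a + s *: w))).
  apply/funext => h; congr (_ *: (V _ - _)).
  by apply/rowP => i; rewrite !mxE /GRing.scale/=; ring.
split; first by rewrite /derivable /= E; exact: Vd.
by move: VdE; rewrite /derive /= E.
Qed.

Lemma increment_approx (R : realType) (g dg : R -> R) (k d e : R) :
  (forall s : R, `|s| <= `|k| -> is_derive s 1 g (dg s)) ->
  (forall s : R, `|s| <= `|k| -> `|dg s - d| <= e) ->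
  `|g k - g 0 - d * k| <= e * `|k|.
Proof.
move=> gd dge.
have gc (s t : R) : (forall r, r \in `[s, t] -> `|r| <= `|k|) ->
    {within `[s, t], continuous g}.
  move=> st; apply: derivable_within_continuous => r rst.
  by have [] := gd r (st r rst).
have [k0|k0] := leP 0 k.
  have sub r : r \in `[0, k] -> `|r| <= `|k|.
    by rewrite in_itv/= => /andP[r0 rk]; rewrite !ger0_norm//; lra.
  have [|c c0k ->] := @MVT_segment R g dg 0 k k0 _ (gc _ _ sub).
    by move=> r rk; apply: gd; apply: sub; exact: subset_itv_oo_cc.
  by rewrite subr0 -mulrBl normrM ler_wpM2r// dge// sub.
have sub r : r \in `[k, 0] -> `|r| <= `|k|.
  by rewrite in_itv/= => /andP[r0 rk]; rewrite !ler0_norm//; lra.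
have [|c c0k] := @MVT_segment R g dg k 0 (ltW k0) _ (gc _ _ sub).
  by move=> r rk; apply: gd; apply: sub; exact: subset_itv_oo_cc.
rewrite sub0r => gE; have -> : g k - g 0 - d * k = (dg c - d) * k by lra.
by rewrite normrM ler_wpM2r// dge// sub.
Qed.

(** The path from [p] to [p + k] changes one coordinate at a time. Each leg is a one-variable mean
    value estimate, and every point on it stays within [|k|] of [p] in the sup norm. *)
Lemma partials_increment (R : realType) (n : nat) (V : 'rV[R]_n -> R)
    (G : 'rV[R]_n -> 'rV[R]_n) (p k : 'rV[R]_n) (e : R) :
  (forall x, `|x - p| <= `|k| -> forall i, is_derive x (delta_mx 0 i) V (G x 0 i)) ->
  (forall x, `|x - p| <= `|k| -> `|G x - G p| <= e) ->
  `|V (p + k) - V p - dot (G p) k| <= n%:R * e * `|k|.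
Proof.
move=> Vd Ge.
have e0 : 0 <= e by rewrite (le_trans _ (Ge p _)) ?subrr ?normr0.
(* [kk j] keeps the first [j] coordinates of [k], so [kk 0] is zero and [kk n] is [k]. *)
pose kk j : 'rV[R]_n := \row_i (if (i < j)%N then k 0 i else 0).
have -> : V (p + k) - V p =
    \sum_(j < n) (V (p + kk j.+1) - V (p + kk j)).
  rewrite -(big_mkord xpredT (fun j => V (p + kk j.+1) - V (p + kk j))).
  rewrite (telescope_sumr (fun j => V (p + kk j)))//.
  congr (V (p + _) - V _).
    by apply/rowP => i; rewrite mxE ltn_ord.
  by apply/rowP => i; rewrite !mxE/= addr0.
rewrite /dot -sumrB (le_trans (ler_norm_sum _ _ _))//.
rewrite (_ : n%:R * e * `|k| = \sum_(j < n) e * `|k|); last first.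
  by rewrite sumr_const card_ord -[RHS]mulr_natl mulrA.
apply: ler_sum => j _.
pose w : 'rV[R]_n := delta_mx 0 j.
have near_p s : `|s| <= `|k 0 j| -> `|p + kk j + s *: w - p| <= `|k|.
  move=> sk; apply: norm_le_coord => // i; rewrite !mxE eqxx/=.
  rewrite addrC !addrA addNr add0r.
  have [->|ij] := eqVneq i j.
    by rewrite ltnn add0r mulr1 (le_trans sk)// coord_le_norm.
  rewrite mulr0 addr0; case: ifP => _; first exact: coord_le_norm.
  by rewrite normr0.
have -> : p + kk j.+1 = p + kk j + k 0 j *: w.
  apply/rowP => i; rewrite !mxE eqxx/= -addrA; congr (_ + _).
  rewrite ltnS leq_eqVlt (_ : (nat_of_ord i == j) = (i == j)) //.
  have [->|ij] := eqVneq i j; first by rewrite ltnn add0r mulr1.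
  by rewrite mulr0 addr0.
have {2}-> : p + kk j = p + kk j + (0 : R) *: w by rewrite scale0r addr0.
apply: (@le_trans _ _ (e * `|k 0 j|)); last by rewrite ler_wpM2l// coord_le_norm.
apply: (@increment_approx R (fun s => V (p + kk j + s *: w))
  (fun s => G (p + kk j + s *: w) 0 j)) => s sk.
  by apply: is_derive_line; exact: Vd (near_p s sk) j.
have := le_trans (coord_le_norm _ j) (Ge _ (near_p s sk)).
by rewrite !mxE.
Qed.

Lemma dot_is_linear (R : realType) (n : nat) (u : 'rV[R]_n) :
  linear (dot u : 'rV[R]_n -> R^o).
Proof.
move=> a v w; rewrite /dot scaler_sumr -big_split/=; apply: eq_bigr => i _.
by rewrite !mxE mulrDr /GRing.scale/= mulrCA.
Qed.

HB.instance Definition _ (R : realType) (n : nat) (u : 'rV[R]_n) :=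
  GRing.isLinear.Build R 'rV[R]_n R^o *:%R (dot u) (dot_is_linear u).

Lemma dot_continuous (R : realType) (n : nat) (u : 'rV[R]_n) :
  continuous (dot u).
Proof.
apply: continuous_big => [|i _ v]; first exact: add_continuous.
apply: cvgMl_tmp; [exact: (nbhs_filter v)|exact: coord_continuous].
Qed.

Lemma partials_differentiable (R : realType) (n : nat) (V : 'rV[R]_n -> R)
    (G : 'rV[R]_n -> 'rV[R]_n) (p : 'rV[R]_n) :
  (\forall x \near p, forall i, is_derive x (delta_mx 0 i) V (G x 0 i)) ->
  {for p, continuous G} ->
  differentiable V p /\ 'd V p = dot (G p) :> ('rV[R]_n -> R).
Proof.
move=> Vd Gc.
have dV : V \o shift p = cst (V p) + dot (G p) +o_ 0 id.
  apply/eqaddoP => e e0.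
  (* Dividing by [n.+1] rather than [n] covers [n = 0]; the factor [n / (n + 1)] that remains is at
     most [1]. *)
  have e'0 : 0 < e / n.+1%:R by rewrite divr_gt0// ltr0n.
  move/cvgrPdist_le : Gc => /(_ _ e'0) Gc.
  have := filterI Vd Gc; rewrite nbhs_ballP => -[r /= r0].
  rewrite -ball_normE /ball_ /= => near_p.
  apply/nbhs_ballP; exists r => //= k.
  rewrite -ball_normE /ball_/= sub0r normrN => kr.
  have sub x : `|x - p| <= `|k| -> `|p - x| < r.
    by rewrite distrC => /le_lt_trans; apply.
  rewrite (_ : (V \o shift p - (cst (V p) + dot (G p))) k =
    V (p + k) - V p - dot (G p) k); last by rewrite -[p + k]addrC -addrA -opprD.
  apply: (le_trans (@partials_increment R n V G p k (e / n.+1%:R) _ _)).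
  - by move=> x /sub /near_p[].
  - by move=> x /sub /near_p[_]; rewrite distrC.
  - rewrite ler_wpM2r// mulrCA ler_piMr ?ltW//.
    by rewrite ltr_pdivrMr ?ltr0n// mul1r ltr_nat.
have dVE := diff_unique (dot_continuous (u := G p)) dV.
split=> //; apply/diff_locallyP; rewrite dVE; split => //.
exact: dot_continuous.
Qed.

Lemma is_derive_along (R : realType) (n : nat) (V : 'rV[R]_n -> R)
    (c : R -> 'rV[R]_n) (t : R) (g dc : 'rV[R]_n) :
  differentiable V (c t) -> 'd V (c t) = dot g :> ('rV[R]_n -> R) ->
  is_derive t 1 c dc -> is_derive t 1 (fun s => V (c s)) (dot g dc).
Proof.
move=> diffV dVE [/derivable1_diffP diffc dcE].
have diffVc : differentiable (V \o c) t by exact: differentiable_comp.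
split; first exact/derivable1_diffP.
by rewrite (deriveE _ diffVc) diff_comp//= dVE -deriveE// dcE.
Qed.

(** * The Euclidean norm and bounds for comparison functions *)

Lemma enorm_ge0 (R : realType) (n : nat) (u : 'rV[R]_n) : 0 <= enorm u.
Proof. exact: sqrtr_ge0. Qed.

Lemma norm_le_enorm (R : realType) (n : nat) (u : 'rV[R]_n) : `|u| <= enorm u.
Proof.
apply: norm_le_coord => [|i]; first exact: enorm_ge0.
rewrite -sqrtr_sqr ler_wsqrtr// (bigD1 i)//= lerDl.
by apply: sumr_ge0 => j _; exact: sqr_ge0.
Qed.

Lemma enorm_continuous (R : realType) (n : nat) :
  continuous (@enorm R n).
Proof.
move=> u; apply: (@continuous_comp _ _ _ (fun u : 'rV[R]_n =>
  \sum_(i < n) u 0 i ^+ 2) Num.sqrt); last exact: sqrt_continuous.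
apply: continuous_big => [|i _ v]; first exact: add_continuous.
apply: (@continuous_comp _ _ _ (fun u : 'rV[R]_n => u 0 i) (fun r => r ^+ 2)).
  exact: coord_continuous.
exact: exprn_continuous.
Qed.

Lemma Rplus_bounded (R : realType) (g : R -> R) (B : R) :
  continuous_Rplus g -> exists2 M, 0 < M & forall s, 0 <= s <= B -> g s <= M.
Proof.
move=> [_ gc]; have [B0|B0] := leP 0 B; last first.
  by exists 1 => // s /andP[s0 sB]; lra.
have gcB : {within `[0, B], continuous g}.
  by apply: continuous_subspaceW gc => r /=; rewrite !in_itv/= => /andP[->].
have [c _ cmax] := EVT_max B0 gcB.
(* The added [1] makes the bound positive, so that it can serve as a divisor. *)
exists (`|g c| + 1) => [|s sB]; first by rewrite ltr_wpDl.
have := cmax s; rewrite in_itv/= => /(_ sB); have := ler_norm (g c); lra.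
Qed.

Lemma Rplus_pos_lower_bound (R : realType) (rho : R -> R) (s0 s1 : R) :
  continuous_Rplus rho -> (forall s, 0 < s -> 0 < rho s) -> 0 < s0 ->
  exists2 m, 0 < m & forall s, s0 <= s <= s1 -> m <= rho s.
Proof.
move=> [_ rhoc] rho_pos s00; have [s01|s10] := leP s0 s1; last first.
  by exists 1 => // s; lra.
have rhoc01 : {within `[s0, s1], continuous rho}.
  apply: continuous_subspaceW rhoc => r /=; rewrite !in_itv/= => /andP[sr _].
  by rewrite (le_trans (ltW s00)).
have [c + cmin] := EVT_min s01 rhoc01; rewrite in_itv/= => /andP[s0c _].
exists (rho c) => [|s ss]; first by apply: rho_pos; lra.
by apply: cmin; rewrite in_itv.
Qed.

Lemma K_infty_lt (R : realType) (a : R -> R) (s t : R) : K_infty a ->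
  0 <= s -> s < t -> a s < a t.
Proof.
move=> [_ a_lt _ _] s0 st; apply: a_lt => //.
  by rewrite in_itv/= s0.
by rewrite in_itv/= (le_trans s0 (ltW st)).
Qed.

Lemma K_infty_gt0 (R : realType) (a : R -> R) (s : R) : K_infty a ->
  0 < s -> 0 < a s.
Proof. by move=> aK s0; have [_ _ <- _] := aK; exact: K_infty_lt. Qed.

(** * Differentiating a function of class C1 along trajectories in the interior *)

Lemma grad_is_gradient (R : realType) (n : nat) (A : set 'rV[R]_n)
    (V : 'rV[R]_n -> R) : C1_Rplus A V -> is_gradient A V (grad A V).
Proof. by move=> [_ GV]; exact: (xgetPex (fun=> 0)). Qed.

Lemma grad_differentiable (R : realType) (n : nat) (A : set 'rV[R]_n)
    (V : 'rV[R]_n -> R) (p : 'rV[R]_n) : C1_Rplus A V -> A° p ->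
  differentiable V p /\ 'd V p = dot (grad A V p) :> ('rV[R]_n -> R).
Proof.
move=> /grad_is_gradient[Vd /subspace_continuousP Gc] Ap.
apply: partials_differentiable.
  by apply: filterS (nbhs_interior Ap) => x /Vd.
by have := Gc p (interior_subset Ap); rewrite within_interior.
Qed.

Section InteriorTrajectory.
Context (R : realType) (n : nat) (S : set 'rV[R]_n) (f : 'rV[R]_n -> 'rV[R]_n).
Context (A : set 'rV[R]_n) (V : 'rV[R]_n -> R) (V_C1 : C1_Rplus A V).
Context (u0 : 'rV[R]_n) (x : R -> 'rV[R]_n).
Context (x_sol : is_solution S f u0 x) (x_in : forall t, 0 <= t -> A° (x t)).

Implicit Types r s t : R.

Let dV t := dot (grad A V (x t)) (f (x t)).

Lemma along_derive t : 0 < t -> is_derive t 1 (V \o x) (dV t).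
Proof.
move=> t0; have [diffV dVE] := grad_differentiable V_C1 (x_in (ltW t0)).
by apply: is_derive_along => //; exact: (solution_derive x_sol).
Qed.

(** [along_derive] excludes time [0], but [V] is differentiable, hence continuous, at the interior
    point [x 0] too. The mean value estimates may therefore start at [s = 0]. *)
Lemma along_continuous s t : 0 <= s -> {within `[s, t], continuous (V \o x)}.
Proof.
move=> s0; apply/subspace_continuousP => r; rewrite /= in_itv/= => /andP[sr rt].
have r0 := le_trans s0 sr.
have [diffV _] := grad_differentiable V_C1 (x_in r0).
have /subspace_continuousP xc := solution_continuous_segment (t := t) x_sol s0.
apply: (@cvg_comp _ _ _ x V _ (nbhs (x r))).
  by apply: xc; rewrite /= in_itv/= sr.
exact: (differentiable_continuous diffV).
Qed.

Lemma along_le s t K : 0 <= s -> s <= t ->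
  (forall r, s <= r <= t -> dV r <= K) -> V (x t) - V (x s) <= K * (t - s).
Proof.
move=> s0 st dVK; apply: (increment_le (g := V \o x) (dg := dV) st).
- by move=> r; rewrite in_itv/= => /andP[sr _]; apply: along_derive; lra.
- exact: along_continuous.
- by move=> r; rewrite in_itv/= => /andP[sr rt]; apply: dVK; lra.
Qed.

Lemma along_ge s t K : 0 <= s -> s <= t ->
  (forall r, s <= r <= t -> K <= dV r) -> K * (t - s) <= V (x t) - V (x s).
Proof.
move=> s0 st dVK.
apply: (increment_ge (g := V \o x) (dg := dV) st).
- by move=> r; rewrite in_itv/= => /andP[sr _]; apply: along_derive; lra.
- exact: along_continuous.
- by move=> r; rewrite in_itv/= => /andP[sr rt]; apply: dVK; lra.
Qed.

End InteriorTrajectory.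

(** * The Lyapunov argument and its passage from the interior to [Omega] *)

Section Stability.
Context (R : realType) (n k : nat) (S : set 'rV[R]_n).
Context (f : 'rV[R]_n -> 'rV[R]_n) (h : 'rV[R]_n -> 'rV[R]_k).
Context (f_lip : [locally [lipschitz f x | x in S]]).
Context (h_cont : {within S, continuous h}) (S_complete : forward_complete S f).
Context (Omega : set 'rV[R]_n) (OmegaS : Omega `<=` S).
Context (Omega_inv : positively_invariant S f Omega).
Context (Omega_between : between_open_and_closure Omega).
Context (a : R -> R) (a_Kinf : K_infty a).
Context (V W : 'rV[R]_n -> R).
Context (V_C1 : C1_Rplus Omega V) (W_C1 : C1_Rplus Omega W).
Context (rho : R -> R) (rho_cont : continuous_Rplus rho).
Context (V_lower : forall x, Omega x -> a (enorm (h x)) <= V x).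
Context (V_decay :
  forall x, Omega x -> dot (grad Omega V x) (f x) <= - rho (W x)).
Implicit Types (u v : 'rV[R]_n) (e r s t B M c : R).

Lemma output_near u t e : Omega u -> 0 <= t -> 0 < e ->
  \forall v \near u, Omega v ->
    `|enorm (output S f h t v) - enorm (output S f h t u)| < e.
Proof.
move=> Ou t0 e0; have Su := OmegaS Ou.
have Sp := flow_in S_complete Su t0.
have : (fun q => enorm (h q)) @ within S (nbhs (flow S f t u)) -->
    enorm (h (flow S f t u)).
  apply: (@cvg_comp _ _ _ h (@enorm R k) _ (nbhs (h (flow S f t u)))).
    by move/subspace_continuousP : h_cont; exact.
  exact: enorm_continuous.
move/cvgrPdist_lt => /(_ _ e0); rewrite near_withinE => /nbhs_ballP[r /= r0].
rewrite -ball_normE /ball_ /= => hr.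
have [d d0 dP] := flow_continuous f_lip S_complete Su t0 r0.
apply/nbhs_ballP; exists d => // v; rewrite -ball_normE /ball_/= => uv Ov.
rewrite distrC; apply: hr; last exact: flow_in (OmegaS Ov) t0.
by rewrite /= distrC; apply: dP; [exact: OmegaS|rewrite distrC].
Qed.

Lemma interior_dense u (P : set 'rV[R]_n) : Omega u -> nbhs u P ->
  exists2 v, Omega° v & P v.
Proof.
have [U [oU UO OU]] := Omega_between; move=> /OU uU /uU[v [Uv Pv]].
by exists v => //; apply: filterS UO _; exact: open_nbhs_nbhs.
Qed.

Lemma flow_along u : Omega° u ->
  is_solution S f u (fun t => flow S f t u) /\
  (forall t, 0 <= t -> Omega° (flow S f t u)).
Proof.
move=> Ou; split; first exact: (flow_solution S_complete (OmegaS (interior_subset Ou))).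
by move=> t; exact: interior_invariant Ou.
Qed.

Lemma V_nonincreasing u s t : Omega° u -> 0 <= s -> s <= t ->
  V (flow S f t u) <= V (flow S f s u).
Proof.
move=> /flow_along[usol u_in] s0 st.
rewrite -subr_le0 -(mul0r (t - s)).
apply: (along_le V_C1 usol u_in) => // r /andP[sr _].
have Or := interior_subset (u_in r (le_trans s0 sr)).
rewrite (le_trans (V_decay Or))// oppr_le0.
by apply: rho_cont.1; case: W_C1 => + _; exact.
Qed.

Lemma V_le_initial u t : Omega° u -> 0 <= t -> V (flow S f t u) <= V u.
Proof.
move=> Ou t0; have := V_nonincreasing Ou (lexx 0) t0.
by rewrite flow0//; exact: OmegaS (interior_subset Ou).
Qed.

(** Serves both Lagrange and Lyapunov stability. Violating the bound is an open condition on the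
    initial state, so an interior [v] near [u] violates it too, and then [a M < V v <= B]. *)
Lemma output_bound r B M : (forall u, Omega u -> enorm u < r -> V u <= B) ->
  0 <= M -> B <= a M -> forall u t, enorm u < r -> Omega u -> 0 <= t ->
  enorm (output S f h t u) <= M.
Proof.
move=> VB M0 BM u t ur Ou t0; rewrite leNgt; apply/negP => Mu.
have ur_near : \forall v \near u, enorm v < r.
  exact: (cvgr_lt _ (@enorm_continuous R n u)).
have := output_near (e := enorm (output S f h t u) - M) Ou t0.
rewrite subr_gt0 => /(_ Mu) => out_near.
have [v Ov [vr /(_ (interior_subset Ov)) vu]] :=
  interior_dense Ou (filterI ur_near out_near).
have Mv : M < enorm (output S f h t v).
  by move: vu; rewrite ltr_norml => /andP[+ _]; lra.
have := K_infty_lt a_Kinf M0 Mv.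
have := V_lower (Omega_inv (interior_subset Ov) t0).
have := V_le_initial Ov t0; have := VB v (interior_subset Ov) vr.
by rewrite /output; lra.
Qed.

Context (rho_pos : forall s, 0 < s -> 0 < rho s).
Context (W_lower : forall x, Omega x -> a (enorm (h x)) <= W x).
Context (W_growth : exists2 gamma : R -> R, continuous_Rplus gamma &
  (forall x, Omega x -> dot (grad Omega W x) (f x) <= gamma (V x)) \/
  (forall x, Omega x -> dot (grad Omega W x) (f x) >= - gamma (V x))).
Context (rho_or_zeta :
  {in `[0, +oo[ &, {homo rho : s t / s <= t}} \/
  (exists2 zeta : R -> R, continuous_Rplus zeta &
    forall x, Omega x -> W x <= zeta (V x))).

Let V_ge0 u : Omega u -> 0 <= V u. Proof. by case: V_C1 => + _; exact. Qed.

(** A positive definite [rho] may tend to zero at infinity. Either monotonicity excludes this, or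
    [zeta] confines [W] to a compact interval [[c, Z]], on which [rho] has a positive minimum. *)
Lemma rho_W_lower_bound B c : 0 < c -> exists2 m, 0 < m &
  forall u, Omega u -> V u <= B -> c <= W u -> m <= rho (W u).
Proof.
move=> c0; case: rho_or_zeta => [rho_mono|[zeta zeta_cont Wzeta]].
  exists (rho c) => [|u Ou _ cW]; first exact: rho_pos.
  by apply: rho_mono => //; rewrite in_itv/= andbT; lra.
have [Z Z0 ZP] := Rplus_bounded B zeta_cont.
have [m m0 mP] := Rplus_pos_lower_bound Z rho_cont rho_pos c0.
exists m => // u Ou uB cW; apply: mP; rewrite cW/=.
by rewrite (le_trans (Wzeta u Ou))// ZP// V_ge0.
Qed.

(** The window extends on both sides of [t] so that one statement serves both forms of the bound on
    the derivative of [W]: the drop occurs in one half, and [V] does not increase in the other. *)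
Lemma V_drop B c : 0 < c -> exists d m : R, [/\ 0 < d, 0 < m &
  forall u, Omega° u -> V u <= B -> forall t, d <= t ->
    c <= W (flow S f t u) ->
    V (flow S f (t + d) u) <= V (flow S f (t - d) u) - m].
Proof.
move=> c0; have [gamma gamma_cont W'] := W_growth.
have [G G0 GP] := Rplus_bounded B gamma_cont.
have c20 : 0 < c / 2 by lra.
have [m m0 mP] := rho_W_lower_bound B c20.
(* At rate at most [G], [W] needs at least this time to go between [c / 2] and [c]. *)
pose d := c / 2 / G; have d0 : 0 < d by rewrite divr_gt0.
have Gd : G * d = c / 2 by rewrite mulrC divfK// gt_eqF.
exists d, (m * d); split => // [|u Ou uB t dt cW]; first by rewrite mulr_gt0.
have [usol u_in] := flow_along Ou.
have in_Omega r : 0 <= r -> Omega (flow S f r u).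
  by move=> r0; exact: interior_subset (u_in r r0).
have gammaG r : 0 <= r -> gamma (V (flow S f r u)) <= G.
  move=> r0; apply: GP; rewrite V_ge0/=; last exact: in_Omega.
  exact: le_trans (V_le_initial Ou r0) uB.
have drop s : 0 <= s -> (forall r, s <= r <= s + d -> c / 2 <= W (flow S f r u)) ->
    V (flow S f (s + d) u) <= V (flow S f s u) - m * d.
  move=> s0 Wc; have := along_le V_C1 usol u_in (t := s + d) (K := - m) s0.
  have -> : - m * (s + d - s) = - (m * d) by ring.
  rewrite lerDl ltW//= lerBlDl => /(_ isT); apply => r srd.
  have r0 : 0 <= r by lra.
  rewrite (le_trans (V_decay (in_Omega r r0)))// lerN2 mP ?Wc//.
    exact: in_Omega.
  exact: le_trans (V_le_initial Ou r0) uB.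
have Gd_ge s : 0 <= s <= d -> G * s <= c / 2.
  by move=> /andP[s0 sd]; rewrite -Gd ler_pM2l.
case: W' => W'.
(* [W] grows at rate at most [G], so it was already at least [c / 2] on [[t - d, t]]. *)
- apply: (@le_trans _ _ (V (flow S f t u))).
    by apply: V_nonincreasing => //; lra.
  have := drop (t - d); rewrite subrK; apply; first lra.
  move=> r trt; have r0 : 0 <= r by lra.
  have rt : r <= t by lra.
  have := along_le W_C1 usol u_in (K := G) r0 rt.
  have := Gd_ge (t - r) ltac:(lra).
  suff : forall q, r <= q <= t ->
      dot (grad Omega W (flow S f q u)) (f (flow S f q u)) <= G.
    by move=> + + H => /H; lra.
  move=> q rqt; have q0 : 0 <= q by lra.
  exact: le_trans (W' _ (in_Omega q q0)) (gammaG q q0).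
(* [W] decreases at rate at most [G], so it remains at least [c / 2] on [[t, t + d]]. *)
- apply: (@le_trans _ _ (V (flow S f t u) - m * d)); last first.
    by rewrite lerD2r; apply: V_nonincreasing => //; lra.
  apply: drop; first lra.
  move=> r trt; have t0 : 0 <= t by lra.
  have tr : t <= r by lra.
  have := along_ge W_C1 usol u_in (K := - G) t0 tr.
  have := Gd_ge (r - t) ltac:(lra).
  suff : forall q, t <= q <= r ->
      - G <= dot (grad Omega W (flow S f q u)) (f (flow S f q u)).
    by move=> + + H => /H; lra.
  move=> q rqt; have q0 : 0 <= q by lra.
  apply: le_trans (W' _ (in_Omega q q0)).
  by rewrite lerN2; exact: gammaG.
Qed.

Lemma output_eventually_small B u e :
  (\forall v \near u, Omega v -> V v <= B) -> Omega u -> 0 < e ->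
  exists T, forall t, T <= t -> enorm (output S f h t u) <= e.
Proof.
move=> VB Ou e0; apply: contrapT => /forallNP unbounded.
have large T : exists t, T <= t /\ e < enorm (output S f h t u).
  have /existsNP[t /not_implyP[Tt /negP]] := unbounded T.
  by rewrite -ltNge; exists t.
have [g gP] := choice large.
have [d [m [d0 m0 drop]]] := V_drop B (K_infty_gt0 a_Kinf e0).
(* Times of large output whose windows of radius [d] overlap at most at endpoints; the first is at
   least [d], so that all windows lie in nonnegative time. *)
pose tau := fix tau j := if j is j'.+1 then g (tau j' + 2 * d) else g d.
have tau_large j : e < enorm (output S f h (tau j) u).
  by case: j => [|j]; exact: (gP _).2.
have tau_step j : tau j + 2 * d <= tau j.+1 by exact: (gP _).1.
have tau_ge j : d <= tau j.
  by elim: j => [|j IHj]; [exact: (gP _).1|have := tau_step j; lra].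
have [N BN] : exists N : nat, B < N%:R * m.
  exists (Num.bound `|B / m|).
  by rewrite -ltr_pdivrMr// (le_lt_trans (ler_norm _))// archi_boundP.
(* Only the first [N] times matter, so a single neighbourhood of [u] serves all of them. *)
have out_near : \forall v \near u, forall j : 'I_N, Omega v ->
    e < enorm (output S f h (tau j) v).
  apply: (filter_forall (nbhs_filter u)) => j.
  have := output_near (e := enorm (output S f h (tau j) u) - e)
    Ou (le_trans (ltW d0) (tau_ge j)).
  rewrite subr_gt0 => /(_ (tau_large j)); apply: filterS => v + Ov => /(_ Ov).
  by rewrite ltr_norml => /andP[+ _]; lra.
have [v Ov [vB v_large]] := interior_dense Ou (filterI VB out_near).
have {}vB := vB (interior_subset Ov).
have step j : (j < N)%N ->
    V (flow S f (tau j + d) v) <= V (flow S f (tau j - d) v) - m.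
  move=> jN; apply: drop => //.
  have tj0 : 0 <= tau j by have := tau_ge j; lra.
  have := v_large (Ordinal jN) (interior_subset Ov) => /= /ltW.
  rewrite le_eqVlt => /predU1P[->|/(K_infty_lt a_Kinf (ltW e0))/ltW/le_trans]; last first.
    by apply; apply: W_lower; exact: Omega_inv (interior_subset Ov) tj0.
  by apply: W_lower; exact: Omega_inv (interior_subset Ov) tj0.
have decrease j : (j < N)%N -> V (flow S f (tau j + d) v) <= B - j.+1%:R * m.
  elim: j => [|j IHj] jN.
    have := step 0%N jN; have t0d : 0 <= tau 0%N - d by have := tau_ge 0%N; lra.
    by have := V_le_initial Ov t0d; lra.
  have := step _ jN; have := IHj (ltnW jN).
  have tjd : 0 <= tau j + d by have := tau_ge j; lra.
  have tjd' : tau j + d <= tau j.+1 - d by have := tau_step j; lra.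
  have := V_nonincreasing Ov tjd tjd'.
  by rewrite -[j.+2%:R]natr1 mulrDl mul1r; lra.
(* With no window, [B < 0] contradicts [0 <= V v <= B]; otherwise the drops make [V] negative after
   the last window. *)
case: N => [|N] in BN out_near v_large step decrease *.
  by have := V_ge0 (interior_subset Ov); lra.
have := decrease N (ltnSn N).
have tN : 0 <= tau N + d by have := tau_ge N; lra.
by have := V_ge0 (Omega_inv (interior_subset Ov) tN); lra.
Qed.

End Stability.

Theorem theorem2 (R : realType) (n k : nat) (S : set 'rV[R]_n)
    (f : 'rV[R]_n -> 'rV[R]_n) (h : 'rV[R]_n -> 'rV[R]_k)
    (S0 : S 0)
    (f_lip : [locally [lipschitz f x | x in S]]) (f0 : f 0 = 0)
    (h_cont : {within S, continuous h}) (h0 : h 0 = 0)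
    (S_complete : forward_complete S f)
    (Omega : set 'rV[R]_n)
    (OmegaS : Omega `<=` S) (Omega_inv : positively_invariant S f Omega)
    (Omega0 : Omega 0) (Omega_between : between_open_and_closure Omega)
    (a b : R -> R) (a_Kinf : K_infty a) (b_Kinf : K_infty b)
    (V W : 'rV[R]_n -> R) (V_C1 : C1_Rplus Omega V) (W_C1 : C1_Rplus Omega W)
    (rho : R -> R)
    (rho_cont : continuous_Rplus rho) (rho_pd : positive_definite rho)
    (V_bounds : forall x, Omega x -> a (enorm (h x)) <= V x <= b (enorm x))
    (V_decay : forall x, Omega x -> dot (grad Omega V x) (f x) <= - rho (W x))
    (W_lower : forall x, Omega x -> a (enorm (h x)) <= W x)
    (W_growth : exists2 gamma : R -> R, continuous_Rplus gamma &
       (forall x, Omega x -> dot (grad Omega W x) (f x) <= gamma (V x)) \/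
       (forall x, Omega x -> dot (grad Omega W x) (f x) >= - gamma (V x)))
    (rho_or_zeta :
       {in `[0, +oo[ &, {homo rho : s t / s <= t}} \/
       (exists2 zeta : R -> R, continuous_Rplus zeta &
          forall x, Omega x -> W x <= zeta (V x))) :
  AOS S f h Omega.
Proof.
have V_lower x : Omega x -> a (enorm (h x)) <= V x by move=> /V_bounds/andP[].
have Vb x r : enorm x < r -> Omega x -> V x <= b r.
  move=> xr /V_bounds/andP[_ /le_trans]; apply; apply/ltW.
  exact: (K_infty_lt b_Kinf (enorm_ge0 x)).
have bound := output_bound f_lip h_cont S_complete OmegaS Omega_inv Omega_between
  a_Kinf V_C1 W_C1 rho_cont V_lower V_decay.
split.
- move=> r r0; have [_ _ _ a_oo] := a_Kinf.
  have [M M0 bM] : exists2 M, 0 <= M & b r <= a M.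
    near (+oo : set_system R) => M; exists M; near: M.
      exact: nbhs_pinfty_ge.
    by move/cvgryPge : a_oo; exact.
  exists M => u t; apply: bound bM u t => // u Ou ur; exact: Vb.
- move=> e e0; have [_ _ b0 _] := b_Kinf; have [[_ b_cont] _ _ _] := b_Kinf.
  have ae := K_infty_gt0 a_Kinf e0.
  have : b @ within `[0, +oo[ (nbhs (0 : R)) --> b 0.
    by move/subspace_continuousP : b_cont; apply; rewrite /= in_itv/= lexx.
  rewrite b0 => /cvgrPdist_lt /(_ _ ae).
  rewrite near_withinE => -[d /= d0 bd]; exists d => // u ud Ou t t0.
  (* Continuity of [b] at [0] gives [b (enorm v) < a e] on the ball of radius [d], so [a e] is the
     level of [V] to use. *)
  apply: (bound d (a e) e) => // [v Ov vd|]; last exact: ltW.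
  have /andP[_ /le_trans] := V_bounds v Ov; apply; apply: ltW.
  have := bd (enorm v); rewrite /= !sub0r !normrN in_itv/= andbT.
  rewrite (ger0_norm (enorm_ge0 v)) => /(_ vd (enorm_ge0 v)).
  exact: le_lt_trans (ler_norm _).
- move=> u Ou; apply/cvgrPdist_lt => e e0.
  (* The margin [1] makes the bound on [V] hold on a whole neighbourhood of [u], as needed to move
     to interior points. *)
  have VB : \forall v \near u, Omega v -> V v <= b (enorm u + 1).
    have : \forall v \near u, enorm v < enorm u + 1.
      by apply: (cvgr_lt _ (@enorm_continuous R n u)); rewrite ltrDl.
    by apply: filterS => v vu; exact: Vb.
  have e20 : 0 < e / 2 by rewrite divr_gt0.
  have [T TP] := output_eventually_small f_lip h_cont S_complete OmegaS Omega_inv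
    Omega_between a_Kinf V_C1 W_C1 rho_cont V_decay rho_pd.2 W_lower W_growth
    rho_or_zeta VB Ou e20.
  near=> t; rewrite sub0r normrN (le_lt_trans (norm_le_enorm _))//.
  rewrite (@le_lt_trans _ _ (e / 2))//; last by lra.
  by apply: TP; near: t; exact: nbhs_pinfty_ge (num_real T).
Unshelve. all: by end_near. Qed.
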